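(* Let $S$ be a regular ordered semigroup without zero element. Then $S$ is a group like ordered semigroup if and only if $e\,\mathcal{H}\,f$ for all $e,f\in E_{\le}(S)$.
   Context: An ordered semigroup $(S,\cdot,\le)$ is a semigroup $(S,\cdot)$ that is a poset $(S,\le)$ such that $a\le b$ implies $ca\le cb$ and $ac\le bc$ for all $a,b,c\in S$. A zero element is an element $0$ with $0x=x0=0$ and $0\le x$ for all $x\in S$. For $H\subseteq S$, $(H]=\{t\in S: t\le h \text{ for some } h\in H\}$. $S$ is regular if $a\in(aSa]$ for every $a\in S$. The set of ordered idempotents is $E_{\le}(S)=\{e\in S: e\le e^2\}$. $S$ is group like if for all $a,b\in S$ there are $x,y\in S$ such that $a\le xb$ and $a\le by$. A nonempty $I\subseteq S$ is a left (right) ideal if $SI\subseteq I$ ($IS\subseteq I$) and $(I]\subseteq I$; $L(a)$ and $R(a)$ denote the smallest left and right ideals containing $a$. Green's relations: $a\,\mathcal{L}\,b$ iff $L(a)=L(b)$; $a\,\mathcal{R}\,b$ iff $R(a)=R(b)$; $\mathcal{H}=\mathcal{L}\cap\mathcal{R}$. *)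

(* Defs.v *)
From HB Require Import structures.
From mathcomp Require Import all_boot all_order.
From mathcomp Require Import boolp classical_sets.

Set Implicit Arguments.
Unset Strict Implicit.
Unset Printing Implicit Defensive.

Local Open Scope group_scope.
Local Open Scope order_scope.
Local Open Scope classical_set_scope.

HB.mixin Record isOrderedSemigroup (d : Order.disp_t) S
    of Semigroup S & Order.POrder d S := {
  le_mulg2l : forall c a b : S, a <= b -> c * a <= c * b;
  le_mulg2r : forall c a b : S, a <= b -> a * c <= b * c
}.

(* The carrier is a choiceType with a boolean order; classically (boolp) every
   type and every Prop-valued order can be so equipped. *)
#[short(type="orderedSemigroupType")]
HB.structure Definition OrderedSemigroup (d : Order.disp_t) :=
  { S of Semigroup S & Order.POrder d S & isOrderedSemigroup d S }.

Section OrderedSemigroupDefs.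
Context {d : Order.disp_t} {S : orderedSemigroupType d}.
Implicit Types (a b e z : S) (I : set S).

Definition is_zero z :=
  (forall x : S, z * x = z /\ x * z = z) /\ (forall x : S, z <= x).

(* The downward closure (H] is [down H]. *)

Definition left_ideal I :=
  [/\ I !=set0, [set s * i | s in setT & i in I] `<=` I & down I `<=` I].

Definition right_ideal I :=
  [/\ I !=set0, [set i * s | i in I & s in setT] `<=` I & down I `<=` I].

(* [smallest C G] is the intersection of all members of C containing G; for
   ideals containing a it is again an ideal, nonempty since it contains a. *)
Definition principal_left a : set S := smallest left_ideal [set a].
Definition principal_right a : set S := smallest right_ideal [set a].

Definition greenL a b := principal_left a = principal_left b.
Definition greenR a b := principal_right a = principal_right b.
Definition greenH a b := greenL a b /\ greenR a b.

Definition ordered_idempotents : set S := [set e | e <= e * e].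

End OrderedSemigroupDefs.

Section OrderedSemigroupClasses.
Context {d : Order.disp_t} (S : orderedSemigroupType d).

Definition regular_osg :=
  forall a : S, down [set a * s * a | s in [set: S]] a.

Definition group_like :=
  forall a b : S, exists x y : S, a <= x * b /\ a <= b * y.

End OrderedSemigroupClasses.

(* Main.v *)
Require Import Defs.
From mathcomp Require Import all_boot all_order.
From mathcomp Require Import boolp classical_sets.

(** Every element of an ordered semigroup generates a principal left ideal, and
    [a <= x * b] forces [L(a)] into [L(b)]; so in a group like ordered semigroup
    all principal left ideals coincide, and dually all principal right ideals,
    whence [H] is the universal relation ([group_like_greenH]).

    For the converse, regularity [a <= a * s * a] produces two ordered
    idempotents attached to [a]: [s * a], for which [a <= a * (s * a)], and
    [a * s], for which [a <= (a * s) * a].  Given a second element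
    [b <= b * t * b], the ordered idempotents of [a] and [b] are [H]-related.
    As [f = t * b] satisfies [f <= f * f], the ideal [L(f)] is just [(Sf]], so
    [s * a <= y * (t * b)] for some [y]; multiplying by [a] on the left gives
    [a <= (a * y * t) * b].  The right-hand inequality is the mirror image,
    with [a * s] and [b * t]. *)

Local Open Scope group_scope.
Local Open Scope order_scope.
Local Open Scope classical_set_scope.

Section PrincipalIdeals.
Context {d : Order.disp_t} {S : orderedSemigroupType d}.
Implicit Types a b x y : S.

Lemma le_mul_principal_left a b x :
  a <= x * b -> principal_left a `<=` principal_left b.
Proof.
move=> le_a t La I [Iid Ib]; apply: La; split=> // _ ->.
have [_ mulI downI] := Iid; apply: downI; exists (x * b); split=> //.
by apply: mulI; exists x => //; exists b => //; apply: Ib.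
Qed.

Lemma le_mul_principal_right a b x :
  a <= b * x -> principal_right a `<=` principal_right b.
Proof.
move=> le_a t Ra I [Iid Ib]; apply: Ra; split=> // _ ->.
have [_ mulI downI] := Iid; apply: downI; exists (b * x); split=> //.
by apply: mulI; exists b; [apply: Ib | exists x].
Qed.

(** In general [L(b)] is the union of [(b]] and [(Sb]]; the hypothesis puts [b]
    in [(Sb]], which is then itself the smallest left ideal containing [b]. *)
Lemma principal_left_le_mul a b y :
  b <= y * b -> principal_left b a -> exists x, a <= x * b.
Proof.
move=> le_b Jb; apply: (Jb [set t | exists x, t <= x * b]); split;
  last by move=> _ ->; exists y.
split; first by exists b, y.
- move=> _ [s _ [i [x le_i] <-]]; exists (s * x).
  by rewrite -mulgA; apply: le_mulg2l.
- move=> t [i [[x le_i] le_t]]; exists x.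
  exact: Order.POrderTheory.le_trans le_i.
Qed.

Lemma principal_right_le_mul a b y :
  b <= b * y -> principal_right b a -> exists x, a <= b * x.
Proof.
move=> le_b Jb; apply: (Jb [set t | exists x, t <= b * x]); split;
  last by move=> _ ->; exists y.
split; first by exists b, y.
- move=> _ [i [x le_i] [s _ <-]]; exists (x * s).
  by rewrite mulgA; apply: le_mulg2r.
- move=> t [i [[x le_i] le_t]]; exists x.
  exact: Order.POrderTheory.le_trans le_i.
Qed.

Lemma principal_left_id a : principal_left a a.
Proof. by move=> I [_]; apply. Qed.

Lemma principal_right_id a : principal_right a a.
Proof. by move=> I [_]; apply. Qed.

End PrincipalIdeals.

Lemma group_like_greenH {d : Order.disp_t} {S : orderedSemigroupType d} :
  group_like S -> forall a b : S, greenH a b.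
Proof.
move=> glS a b; have [x [y [ax ay]]] := glS a b.
have [u [v [bu bv]]] := glS b a.
split; apply/seteqP; split.
- exact: le_mul_principal_left ax.
- exact: le_mul_principal_left bu.
- exact: le_mul_principal_right ay.
- exact: le_mul_principal_right bv.
Qed.

Lemma regular_inverse {d : Order.disp_t} {S : orderedSemigroupType d} :
  regular_osg S -> forall a : S, exists s,
  [/\ a <= a * s * a, ordered_idempotents (s * a)
    & ordered_idempotents (a * s)].
Proof.
move=> Sreg a; have [_ [[s _ <-] le_a]] := Sreg a; exists s; split=> //.
- by rewrite /ordered_idempotents /= -mulgA; apply: le_mulg2l; rewrite mulgA.
- by rewrite /ordered_idempotents /= mulgA; apply: le_mulg2r.
Qed.

Theorem theorem3p9 (d : Order.disp_t) (S : orderedSemigroupType d)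
    (Sreg : regular_osg S)
    (Snozero : ~ (exists z : S, is_zero z)) :
  group_like S <->
  (forall e f : S, ordered_idempotents e -> ordered_idempotents f ->
     greenH e f).
Proof.
split=> [glS e f _ _|HE a b]; first exact: group_like_greenH.
have [s [le_a sa_id as_id]] := regular_inverse Sreg a.
have [t [_ tb_id bt_id]] := regular_inverse Sreg b.
have [eqL _] := HE _ _ sa_id tb_id; have [_ eqR] := HE _ _ as_id bt_id.
have [y le_sa] : exists y, s * a <= y * (t * b).
  by apply: (principal_left_le_mul _ _ _ tb_id); rewrite -eqL;
    apply: principal_left_id.
have [z le_as] : exists z, a * s <= (b * t) * z.
  by apply: (principal_right_le_mul _ _ _ bt_id); rewrite -eqR;
    apply: principal_right_id.
exists (a * y * t), (t * z * a); split;
  apply: (Order.POrderTheory.le_trans le_a).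
- by rewrite -!mulgA; apply: le_mulg2l.
- by rewrite !mulgA; apply: le_mulg2r.
Qed.
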